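(* Let $f:\mathbb{R}^n\to\overline{\mathbb{R}}$ be a proper closed convex function with $S=\operatorname{argmin}_{x\in\mathbb{R}^n}f(x)\neq\emptyset$, $f^\star=\min_x f(x)$, and let $\nu>0$. Suppose $f$ satisfies (PL) (or (EB), (RSI), (QG)), as defined in the context, over the sublevel set $[f\le f^\star+\nu]$. Let $\{c_k\}_{k\ge0}$ be a positive sequence bounded away from zero, let $x_0\in\mathbb{R}^n$ be any initial point, and let $\{x_k\}$ be generated by the proximal point method $$x_{k+1}=\operatorname{argmin}_{x\in\mathbb{R}^n}\ f(x)+\frac{1}{2c_k}\|x-x_k\|^2,\qquad k=0,1,2,\dots$$ Then for all $k\ge k_0=\dfrac{\mathrm{dist}^2(x_0,S)}{2\nu\inf_{k\ge0}c_k}$, $$f(x_{k+1})-f^\star\le\omega_k\,(f(x_k)-f^\star),\qquad \mathrm{dist}(x_{k+1},S)\le\theta_k\,\mathrm{dist}(x_k,S),$$ where $$\omega_k=\frac{1}{1+c_k\mu_{\mathrm p}}<1,\qquad \theta_k=\min\left\{\frac{1}{\sqrt{c_k\mu_{\mathrm q}+1}},\ \frac{1}{\sqrt{c_k^2/\mu_{\mathrm e}^2+1}}\right\}<1,$$ and $\mu_{\mathrm p},\mu_{\mathrm e},\mu_{\mathrm q}>0$ are constants with which (PL), (EB), (QG), respectively, hold over $[f\le f^\star+\nu]$ (for convex $f$ the four conditions are equivalent, so such constants exist).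
   Context: $\overline{\mathbb{R}}=\mathbb{R}\cup\{\pm\infty\}$; $\|\cdot\|$ is the Euclidean norm. $f$ is proper if $f>-\infty$ everywhere and $f(x)<\infty$ for some $x$; closed if its epigraph is closed. $\partial f(x)$ is the convex subdifferential. $\mathrm{dist}(x,C)=\min_{y\in C}\|x-y\|$ for closed $C$ (with $\mathrm{dist}(x,\emptyset)=+\infty$), $\Pi_S(x)=\operatorname{argmin}_{y\in S}\|x-y\|$ and $[f\le a]=\{x:f(x)\le a\}$. Conditions over $[f\le f^\star+\nu]$: (RSI) there is $\mu_{\mathrm r}>0$ with $\mu_{\mathrm r}\,\mathrm{dist}^2(x,S)\le\langle g,x-\hat x\rangle$ for all $x\in[f\le f^\star+\nu]$, $g\in\partial f(x)$, $\hat x\in\Pi_S(x)$. (EB) there is $\mu_{\mathrm e}>0$ with $\mathrm{dist}(x,S)\le\mu_{\mathrm e}\,\mathrm{dist}(0,\partial f(x))$ for all $x\in[f\le f^\star+\nu]$. (PL) there is $\mu_{\mathrm p}>0$ with $2\mu_{\mathrm p}(f(x)-f^\star)\le\mathrm{dist}^2(0,\partial f(x))$ for all $x\in[f\le f^\star+\nu]$. (QG) there is $\mu_{\mathrm q}>0$ with $\frac{\mu_{\mathrm q}}{2}\,\mathrm{dist}^2(x,S)\le f(x)-f^\star$ for all $x\in[f\le f^\star+\nu]$. *)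

(* Defs.v *)
From HB Require Import structures.
From mathcomp Require Import all_boot all_order all_algebra.
From mathcomp Require Import all_classical all_reals all_analysis.

Set Implicit Arguments.
Unset Strict Implicit.
Unset Printing Implicit Defensive.

Import Order.TTheory GRing.Theory Num.Theory.
Import numFieldNormedType.Exports.

Local Open Scope classical_set_scope.
Local Open Scope ring_scope.

Section Euclidean.
Variables (R : realType) (n : nat).
Implicit Types (u v x : 'rV[R]_n) (C : set 'rV[R]_n).

(* The norm `|x| that the library puts on 'rV[R]_n is the sup norm, hence a
   separate Euclidean norm; both induce the same topology. *)
Definition dotp u v : R := \sum_(i < n) u 0 i * v 0 i.

Definition enorm u : R := Num.sqrt (dotp u u).

(* For C closed and nonempty the infimum is attained; for C empty it is +oo. *)
Definition dist x C : \bar R := ereal_inf [set (enorm (x - y))%:E | y in C].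

End Euclidean.

Definition argmin_on (R : realType) (T : Type) (D : set T) (h : T -> \bar R) :
  set T := [set x | D x /\ forall y, D y -> (h x <= h y)%E].

Definition argmin (R : realType) (T : Type) (h : T -> \bar R) : set T :=
  argmin_on setT h.

Definition projection (R : realType) (n : nat) (C : set 'rV[R]_n) (x : 'rV[R]_n) :
  set 'rV[R]_n := argmin_on C (fun y => (enorm (x - y))%:E).

Section ExtendedRealFunctions.
Variables (R : realType) (n : nat).
Implicit Types (f : 'rV[R]_n -> \bar R) (nu mu c : R) (x g : 'rV[R]_n).
Local Open Scope ereal_scope.

Definition proper_efunction f : Prop :=
  (forall x, -oo < f x) /\ (exists x, f x < +oo).

Definition epigraph f : set ('rV[R]_n * R) := [set p | f p.1 <= p.2%:E].

Definition closed_efunction f : Prop := closed (epigraph f).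

(* Only used together with [proper_efunction f], so that +oo and -oo are never added. *)
Definition convex_efunction f : Prop :=
  forall (x y : 'rV[R]_n) (t : R), (0 <= t <= 1)%R ->
    f (t *: x + (1 - t) *: y)%R <= t%:E * f x + (1 - t)%:E * f y.

Definition subdiff f x : set 'rV[R]_n :=
  [set g | forall y, f x + (dotp g (y - x)%R)%:E <= f y].

Definition fstar f : \bar R := ereal_inf (range f).

Definition sublevel f (a : \bar R) : set 'rV[R]_n := [set x | f x <= a].

(* The predicates with the extra argument mu say that the condition over
   [f <= fstar f + nu] holds with the constant mu. *)

Definition RSI_with f nu mu : Prop :=
  (0 < mu)%R /\
  forall x g xhat, sublevel f (fstar f + nu%:E) x -> subdiff f x g ->
    projection (argmin f) x xhat ->
    mu%:E * dist x (argmin f) ^+ 2 <= (dotp g (x - xhat)%R)%:E.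

Definition EB_with f nu mu : Prop :=
  (0 < mu)%R /\
  forall x, sublevel f (fstar f + nu%:E) x ->
    dist x (argmin f) <= mu%:E * dist 0%R (subdiff f x).

Definition PL_with f nu mu : Prop :=
  (0 < mu)%R /\
  forall x, sublevel f (fstar f + nu%:E) x ->
    (2 * mu)%:E * (f x - fstar f) <= dist 0%R (subdiff f x) ^+ 2.

Definition QG_with f nu mu : Prop :=
  (0 < mu)%R /\
  forall x, sublevel f (fstar f + nu%:E) x ->
    (mu / 2)%:E * dist x (argmin f) ^+ 2 <= f x - fstar f.

Definition RSI f nu : Prop := exists mu, RSI_with f nu mu.
Definition EB f nu : Prop := exists mu, EB_with f nu mu.
Definition PL f nu : Prop := exists mu, PL_with f nu mu.
Definition QG f nu : Prop := exists mu, QG_with f nu mu.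

Definition prox_objective f c (z : 'rV[R]_n) : 'rV[R]_n -> \bar R :=
  fun x => f x + (1 / (2 * c) * enorm (x - z) ^+ 2)%:E.

(* The objective has at most one minimizer when f is proper and convex, so
   membership in the argmin is the same as being "the" argmin. *)
Definition proximal_point_sequence f (c : nat -> R) (x : nat -> 'rV[R]_n) :
  Prop := forall k, argmin (prox_objective f (c k) (x k)) (x k.+1).

End ExtendedRealFunctions.

(* Main.v *)
Require Import Defs.
From HB Require Import structures.
From mathcomp Require Import all_boot all_order all_algebra.
From mathcomp Require Import all_classical all_reals all_analysis.
From mathcomp Require Import ring lra.

(** Write m for the minimum of f, S for its set of minimisers, and let y be the
proximal point of z with step c.  Comparing y with the points of the segment
from y to an arbitrary w shows that (z - y) / c is a subgradient of f at y
([prox_subgradient]); everything about the method comes from this subgradient.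
Tested at z it gives the descent f y + |z - y|^2 / c <= f z ([prox_descent]);
tested at a minimiser s it gives
|y - s|^2 + |z - y|^2 + 2 c (f y - m) <= |z - s|^2 ([prox_fejer]).

The contraction of the values combines the descent with (PL), which bounds
f y - m by a multiple of |z - y|^2 / c^2.  The two contractions of the distance
combine the second inequality, for s the projection of z on S, with (QG), which
bounds f y - m from below, or with (EB), which bounds |z - y| from below.  These
arguments use the conditions at y, which lies in the sublevel set as soon as z
does.
Summing the second inequality along the iteration, with the values decreasing,
gives f (x k) - m <= dist^2(x 0, S) / (2 k inf c), and the bound on k is exactly
what makes the right-hand side at most nu ([proximal_point_sublevel]).

That all four conditions hold as soon as one does is the cycle
(RSI) -> (EB) -> (PL) -> (QG) -> (RSI).  All the arrows but (PL) -> (QG) need no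
more than Cauchy-Schwarz and the subgradient inequality at the projection.  For
(PL) -> (QG) ([QG_of_PL]) the usual gradient flow is replaced by one
minimisation: a minimiser z of sqrt (f - m) + kappa |. - x| must belong to S
when kappa is small with respect to sqrt mu, because otherwise (PL) makes
sqrt (f - m) decrease at a rate larger than kappa from z to a proximal point of
z.  Comparing the values at z and at x then gives
kappa dist(x, S) <= sqrt (f x - m).

The minimisers that are needed (projections, proximal points and z) come from
[coercive_min], applied to a closed set of pairs (x, r), in general the epigraph
of f: on the epigraph an extended-real objective becomes a continuous real
function of the pair. *)

Set Implicit Arguments.
Unset Strict Implicit.
Unset Printing Implicit Defensive.

Import Order.TTheory GRing.Theory Num.Theory.
Import numFieldNormedType.Exports.

Local Open Scope classical_set_scope.
Local Open Scope ring_scope.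

(** * Euclidean geometry of row vectors *)

Section EuclideanGeometry.
Variables (R : realType) (n : nat).
Implicit Types (u v w x y : 'rV[R]_n) (a : R).

Lemma dotpC u v : dotp u v = dotp v u.
Proof. by apply: eq_bigr => i _; rewrite mulrC. Qed.

Lemma dotpDl u v w : dotp (u + v) w = dotp u w + dotp v w.
Proof. by rewrite -big_split /=; apply: eq_bigr => i _; rewrite mxE mulrDl. Qed.

Lemma dotpZl a u v : dotp (a *: u) v = a * dotp u v.
Proof. by rewrite mulr_sumr; apply: eq_bigr => i _; rewrite mxE mulrA. Qed.

Lemma dotpDr u v w : dotp u (v + w) = dotp u v + dotp u w.
Proof. by rewrite dotpC dotpDl !(dotpC u). Qed.

Lemma dotpZr a u v : dotp u (a *: v) = a * dotp u v.
Proof. by rewrite dotpC dotpZl (dotpC u). Qed.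

Lemma dotpNl u v : dotp (- u) v = - dotp u v.
Proof. by rewrite -scaleN1r dotpZl mulN1r. Qed.

Lemma dotpNr u v : dotp u (- v) = - dotp u v.
Proof. by rewrite dotpC dotpNl dotpC. Qed.

Definition dotpE := (dotpDl, dotpDr, dotpNl, dotpNr, dotpZl, dotpZr).

Lemma dotp_ge0 u : 0 <= dotp u u.
Proof. by apply: sumr_ge0 => i _; rewrite -expr2 sqr_ge0. Qed.

Lemma enorm_ge0 u : 0 <= enorm u.
Proof. exact: sqrtr_ge0. Qed.

Lemma sqr_enorm u : enorm u ^+ 2 = dotp u u.
Proof. exact/sqr_sqrtr/dotp_ge0. Qed.

Lemma enormN u : enorm (- u) = enorm u.
Proof. by rewrite /enorm !dotpE opprK. Qed.

Lemma enorm_distC u v : enorm (u - v) = enorm (v - u).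
Proof. by rewrite -enormN opprB. Qed.

Lemma enorm0 : enorm (0 : 'rV[R]_n) = 0.
Proof. by rewrite /enorm -(scale0r 0) dotpZl mul0r sqrtr0. Qed.

Lemma coord_le_enorm u i : `|u 0 i| <= enorm u.
Proof.
rewrite -sqrtr_sqr ler_wsqrtr // /dotp (bigD1 i) //= -expr2 lerDl.
by apply: sumr_ge0 => j _; rewrite -expr2 sqr_ge0.
Qed.

Lemma enorm_eq0 u : enorm u = 0 -> u = 0.
Proof.
move=> u0; apply/rowP => i; rewrite mxE; apply/normr0_eq0/le_anti.
by rewrite normr_ge0 andbT -u0 coord_le_enorm.
Qed.

Lemma cauchy_schwarz u v : dotp u v <= enorm u * enorm v.
Proof.
have [u0|u0] := eqVneq (enorm u) 0.
  by rewrite (enorm_eq0 u0) -(scale0r 0) dotpZl !mul0r scale0r enorm0 mul0r.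
have [v0|v0] := eqVneq (enorm v) 0.
  by rewrite (enorm_eq0 v0) -(scale0r 0) dotpZr !mul0r scale0r enorm0 mulr0.
have uv_gt0 : 0 < enorm u * enorm v.
  by rewrite mulr_gt0 // lt_neqAle eq_sym enorm_ge0 ?u0 ?v0.
(* The square of this vector is 2 |u| |v| (|u| |v| - <u, v>). *)
have := dotp_ge0 (enorm v *: u - enorm u *: v).
rewrite !dotpE -!sqr_enorm (dotpC v u) => H.
by rewrite -(ler_pM2l uv_gt0); nra.
Qed.

Lemma enormD u v : enorm (u + v) <= enorm u + enorm v.
Proof.
rewrite -ler_sqr ?nnegrE ?addr_ge0 ?enorm_ge0 // sqr_enorm !dotpE -!sqr_enorm.
by rewrite (dotpC v); have := cauchy_schwarz u v; nra.
Qed.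

Lemma enorm_sub_continuous x : continuous (fun y => enorm (y - x)).
Proof.
have cc i : continuous (fun y : 'rV[R]_n => (y - x) 0 i).
  rewrite [X in continuous X](_ : _ = fun y : 'rV[R]_n => y 0 i - x 0 i).
    by move=> y; apply: continuousB;
      [exact: coord_continuous | exact: cst_continuous].
  by apply/funext => y; rewrite !mxE.
have cdot : continuous (fun y : 'rV[R]_n => dotp (y - x) (y - x)).
  apply: continuous_big => [|i _ y]; first exact: add_continuous.
  by apply: continuousM; exact: cc.
move=> y; apply: (@continuous_comp _ _ _ (fun y => dotp (y - x) (y - x))).
  exact: cdot.
exact: sqrt_continuous.
Qed.

Lemma enorm_fst_continuous x :
  continuous (fun q : 'rV[R]_n * R => enorm (q.1 - x)).
Proof.
move=> q; apply: (@continuous_comp ('rV[R]_n * R)%type 'rV[R]_n R fst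
  (fun y => enorm (y - x)) q); first exact: cvg_fst.
exact: enorm_sub_continuous.
Qed.

End EuclideanGeometry.

(** * Existence of minimisers, distances and projections *)

Section Minimisation.
Variables (R : realType) (n : nat).
Implicit Types (x : 'rV[R]_n) (C : set 'rV[R]_n).

(** The points of [E] below the level of [(x0, r0)] lie in a compact box, where
the extreme value theorem applies.  The box constrains each coordinate
separately, and the Euclidean norm dominates every coordinate. *)
Lemma coercive_min (E : set ('rV[R]_n * R)) (G : 'rV[R]_n * R -> R) x0 r0
    (b M : R) :
  closed E -> E (x0, r0) -> continuous G ->
  (forall x r, E (x, r) -> G (x, r) <= G (x0, r0) ->
     enorm (x - x0) <= b /\ `|r| <= M) ->
  exists x r, E (x, r) /\ forall x' r', E (x', r') -> G (x, r) <= G (x', r').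
Proof.
move=> clE Ex0 cG bounded.
pose box : set ('rV[R]_n * R) :=
  [set u : 'rV[R]_n | forall i, `[x0 0 i - b, x0 0 i + b]%classic (u ord0 i)]
  `*` `[- M, M]%classic.
have cbox : compact box.
  apply: compact_setX; last exact: segment_compact.
  by apply: (@rV_compact _ _ (fun i => `[x0 0 i - b, x0 0 i + b]%classic)) => i;
     exact: segment_compact.
have inbox x r : E (x, r) -> G (x, r) <= G (x0, r0) -> (box `&` E) (x, r).
  move=> Exr /(bounded _ _ Exr)[xb rM]; split=> //; split=> /=; last first.
    by rewrite in_itv /= -ler_norml.
  move=> i; rewrite in_itv /= -ler_distl.
  apply: le_trans xb; have := coord_le_enorm (x - x0) i.
  by rewrite !mxE.
have [] := @compact_EVT_min _ _ G (box `&` E).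
- by exists (x0, r0); apply: inbox.
- exact: compact_closedI.
- exact: continuous_subspaceT.
case=> x r; rewrite inE => -[_ Exr] Gmin; exists x, r; split=> // x' r' Ex'.
have [le_x'|/ltW lt_x'] := leP (G (x', r')) (G (x0, r0)).
  by apply: Gmin; rewrite inE; exact: inbox.
by apply: le_trans lt_x'; apply: Gmin; rewrite inE; exact: inbox.
Qed.

Lemma dist_projection C x p :
  projection C x p -> dist x C = (enorm (x - p))%:E.
Proof.
case=> Cp pmin; apply/le_anti/andP; split.
  by apply: ereal_inf_lbound; exists p.
by apply: le_ereal_inf_tmp => _ [y Cy <-]; exact: pmin.
Qed.

Lemma projection_exists C x :
  closed C -> C !=set0 -> exists p, projection C x p.
Proof.
move=> clC [p0 Cp0].
(* Seen as a set of pairs, C is placed at height 0. *)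
have [||||p [r [[/= Cp _] pmin]]] := @coercive_min (C `*` [set 0])
    (fun q => enorm (q.1 - x)) p0 0 (enorm (p0 - x) + enorm (p0 - x)) 0.
- apply: (@closedI _ (fst @^-1` C) (snd @^-1` [set 0])).
    by apply: (continuous_closedP fst).1 => // q; exact: cvg_fst.
  by apply: (continuous_closedP snd).1 (@closed_eq _ _) => q; exact: cvg_snd.
- by [].
- exact: enorm_fst_continuous.
- move=> y r [/= _ ->] yx; rewrite normr0; split=> //.
  rewrite -(subrKA x); apply: le_trans (enormD _ _) _.
  by rewrite (enorm_distC x) lerD2r.
exists p; split=> // y Cy; rewrite lee_fin !(enorm_distC x).
exact: (pmin y 0).
Qed.

Lemma dist0_le C g : C g -> (dist 0 C <= (enorm g)%:E)%E.
Proof.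
by move=> Cg; apply: ereal_inf_lbound; exists g; rewrite // sub0r enormN.
Qed.

(** Together with [le_sqr_dist0], the way to bound the distance of 0 to a
subdifferential from below: an empty one, at distance +oo, needs no separate
case. *)
Lemma le_dist0 C (r : R) :
  (forall g, C g -> r <= enorm g) -> (r%:E <= dist 0 C)%E.
Proof.
move=> le_r; apply: le_ereal_inf_tmp => _ [g Cg <-].
by rewrite sub0r enormN lee_fin; exact: le_r.
Qed.

Lemma dist0_ge0 C : (0 <= dist 0 C)%E.
Proof. by apply: le_dist0 => g _; exact: enorm_ge0. Qed.

Lemma sqr_dist0_le C g : C g -> (dist 0 C ^+ 2 <= (enorm g ^+ 2)%:E)%E.
Proof.
by move=> Cg; rewrite EFin_expe !expe2 lee_pmul ?dist0_ge0 ?dist0_le.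
Qed.

Lemma le_sqr_dist0 C (r : R) :
  (forall g, C g -> r <= enorm g ^+ 2) -> (r%:E <= dist 0 C ^+ 2)%E.
Proof.
move=> le_r; have [r_lt0|r_ge0] := ltP r 0.
  apply: (@le_trans _ _ 0%E); first by rewrite lee_fin ltW.
  by rewrite expe2 mule_ge0 ?dist0_ge0.
rewrite -(sqr_sqrtr r_ge0) EFin_expe !expe2.
have le_sqrt : ((Num.sqrt r)%:E <= dist 0 C)%E.
  apply: le_dist0 => g /le_r /ler_wsqrtr.
  by rewrite sqrtr_sqr ger0_norm ?enorm_ge0.
by rewrite lee_pmul ?lee_fin ?sqrtr_ge0.
Qed.

End Minimisation.

(** * Two inequalities between real numbers *)

(** A <= B + e / 4 and B <= e give A^2 <= B^2 + e^2 / 2 + e^2 / 16, which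
reaches B^2 + e^2 only if e = 0; then B = 0 and A <= B. *)
Lemma descent_forces_zero (R : realFieldType) (A B e : R) :
  0 <= A -> 0 <= B -> 0 <= e ->
  B ^+ 2 + e ^+ 2 <= A ^+ 2 -> B <= e -> A <= B + e / 4 -> A = 0.
Proof.
move=> A0 B0 e0 AB Be Ae.
have e2 : e ^+ 2 <= 0 by nra.
have {}e2 : e = 0 by apply/eqP; rewrite -sqrf_eq0 eq_le e2 sqr_ge0.
by subst e; lra.
Qed.

Lemma le_contraction (R : rcfType) (D D' K : R) : 0 < K -> 0 <= D -> 0 <= D' ->
  D ^+ 2 * K <= D' ^+ 2 -> D <= 1 / Num.sqrt K * D'.
Proof.
move=> K_gt0 D0 D'0 DK; rewrite mul1r ler_pdivlMl ?sqrtr_gt0 //.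
rewrite -ler_sqr ?nnegrE ?mulr_ge0 ?sqrtr_ge0 // exprMn.
by rewrite sqr_sqrtr ?(ltW K_gt0) // mulrC.
Qed.

(** * Proximal points of a closed convex function *)

Lemma fstar_fin (R : realType) (n : nat) (f : 'rV[R]_n -> \bar R) :
  proper_efunction f -> argmin f !=set0 -> exists m, fstar f = m%:E.
Proof.
move=> [f_gtNy [w fw]] [s [_ mins]].
have -> : fstar f = f s.
  apply/le_anti/andP; split; first by apply: ereal_inf_lbound; exists s.
  by apply: le_ereal_inf_tmp => _ [y _ <-]; exact: mins.
have := f_gtNy s; have := le_lt_trans (mins w I) fw.
by case: (f s) => // m; exists m.
Qed.

Section ClosedConvexFunction.
Variables (R : realType) (n : nat) (f : 'rV[R]_n -> \bar R) (m : R).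
Hypotheses (f_closed : closed_efunction f) (f_convex : convex_efunction f).
Hypothesis fstarE : fstar f = m%:E.
Implicit Types (x y z s g : 'rV[R]_n) (a b c mu nu : R).

Lemma fstar_le x : (m%:E <= f x)%E.
Proof. by rewrite -fstarE; apply: ereal_inf_lbound; exists x. Qed.

Lemma argminE x : argmin f x <-> f x = m%:E.
Proof.
split=> [[_ minx]|fx]; last by split=> // y _; rewrite fx fstar_le.
apply/le_anti; rewrite fstar_le andbT -fstarE.
by apply: le_ereal_inf_tmp => _ [y _ <-]; exact: minx.
Qed.

(** The minimisers are the points at height m of the closed epigraph. *)
Lemma closed_argmin : closed (argmin f).
Proof.
have -> : argmin f = (fun x => (x, m)) @^-1` epigraph f.
  apply/seteqP; split=> x; rewrite /epigraph /=; first by move/argminE->.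
  by move=> fx; apply/argminE/le_anti; rewrite fx fstar_le.
apply: (continuous_closedP _).1 f_closed => x.
exact: (cvg_pair (F:=nbhs x) cvg_id (cvg_cst m)).
Qed.

Lemma le_fin_value x a : (f x <= a%:E)%E ->
  exists b, [/\ f x = b%:E, m <= b & b <= a].
Proof.
have := fstar_le x; case: (f x) => [b||] //; rewrite !lee_fin => mb ba.
by exists b.
Qed.

Lemma sublevel_fin nu x : sublevel f (fstar f + nu%:E)%E x ->
  exists b, [/\ f x = b%:E, m <= b & b <= m + nu].
Proof. by rewrite /sublevel /= fstarE -EFinD => /le_fin_value. Qed.

(** The optimality condition of the proximal problem: moving from y towards w by
a fraction t changes the quadratic term to first order by
- t <(z - y) / c, w - y>, which f has to compensate, and convexity bounds the
change of f by t (f w - f y); then t tends to 0. *)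
Lemma prox_subgradient c z y : proper_efunction f -> 0 < c ->
  argmin (prox_objective f c z) y ->
  exists2 b, f y = b%:E & subdiff f y (c^-1 *: (z - y)).
Proof.
move=> [_ [w0 fw0]] c_gt0 [_ miny].
have [a0 fa0] : exists a, f w0 = a%:E.
  by case: (f w0) (fstar_le w0) fw0 => // a _ _; exists a.
have [b fb] : exists b, f y = b%:E.
  have := miny w0 I; rewrite /prox_objective fa0 -EFinD.
  by case: (f y) (fstar_le y) => // b _ _; exists b.
exists b => // w; rewrite fb.
have := fstar_le w; case fw : (f w) => [a||] // _; last by rewrite leey.
rewrite -EFinD lee_fin.
have key t : 0 < t -> t <= 1 ->
    b + dotp (c^-1 *: (z - y)) (w - y)
      <= a + t * (c^-1 / 2 * dotp (w - y) (w - y)).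
  move=> t_gt0 t_le1.
  have t01 : 0 <= t <= 1 by rewrite ltW.
  have := miny (t *: w + (1 - t) *: y) I.
  have := f_convex w y t01; rewrite fw fb -!EFinM -EFinD.
  move=> /le_fin_value[d [fd _ db]].
  rewrite /prox_objective fd fb -!EFinD lee_fin !sqr_enorm.
  have -> : t *: w + (1 - t) *: y - z = (y - z) + t *: (w - y).
    by apply/rowP => i; rewrite !mxE; ring.
  have -> : 1 / (2 * c) = c^-1 / 2 by rewrite mul1r invfM mulrC.
  rewrite -(opprB y z); move: (y - z) (w - y) c^-1 => u v k.
  rewrite !dotpE (dotpC v u) => mint; rewrite -(ler_pM2l t_gt0); lra.
apply/ler_addgt0Pr => e e_gt0.
set K := c^-1 / 2 * dotp (w - y) (w - y).
have K_ge0 : 0 <= K by rewrite mulr_ge0 ?dotp_ge0 ?divr_ge0 ?invr_ge0 ?ltW.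
have Ke_gt0 : 0 < K + e by rewrite ltr_wpDl.
(* This t is at most 1 and t * K <= e, including when K = 0. *)
have t_gt0 : 0 < e / (K + e) by rewrite divr_gt0.
have t_le1 : e / (K + e) <= 1 by rewrite ler_pdivrMr // mul1r lerDr.
apply: le_trans (key _ t_gt0 t_le1) _; rewrite lerD2l -/K.
by rewrite mulrAC ler_pdivrMr // ler_wpM2l ?lerDl ?(ltW e_gt0) //.
Qed.

Lemma prox_exists c z a : 0 < c -> f z = a%:E ->
  exists y, argmin (prox_objective f c z) y.
Proof.
move=> c_gt0 fz; set k := 1 / (2 * c).
have k_gt0 : 0 < k by rewrite divr_gt0 ?mulr_gt0.
have [|||y [r [/= Ey miny]]] := @coercive_min _ _ (epigraph f)
    (fun q => q.2 + k * enorm (q.1 - z) ^+ 2) z a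
    ((a - m) / k + 1) (`|a| + `|m|) f_closed.
- by rewrite /epigraph /= fz.
- move=> q; apply: continuousD; first exact: cvg_snd.
  apply: continuousM; first exact: cst_continuous.
  by apply: continuousM; exact: enorm_fst_continuous.
- move=> y r /= /le_fin_value /= [b [fy mb br]].
  rewrite subrr enorm0 expr0n /= mulr0 addr0 => le_a.
  have d_ge0 : 0 <= k * enorm (y - z) ^+ 2 by rewrite mulr_ge0 ?sqr_ge0 ?ltW.
  split; last first.
    have := ler_norm a; have := ler_norm (- m); rewrite normrN ler_norml.
    by have := normr_ge0 a; have := normr_ge0 m => *; apply/andP; split; lra.
  have : enorm (y - z) ^+ 2 <= (a - m) / k by rewrite ler_pdivlMr //; lra.
  (* A bound on the square bounds the norm, since 2 X <= X^2 + 1. *)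
  have := sqr_ge0 (enorm (y - z) - 1); have := sqr_ge0 (enorm (y - z)).
  by rewrite sqrrB expr1n mulr1 => *; lra.
exists y; split=> // w _; rewrite /prox_objective -/k.
have := fstar_le w; case fw : (f w) => [b||] // _; last first.
  by rewrite addye // leey.
apply: (@le_trans _ _ (r%:E + (k * enorm (y - z) ^+ 2)%:E)%E).
  by rewrite leeD2r.
by rewrite -!EFinD lee_fin; apply: miny; rewrite /epigraph /= fw.
Qed.

Lemma prox_descent c z y a b : f z = a%:E -> f y = b%:E ->
  subdiff f y (c^-1 *: (z - y)) -> b + enorm (z - y) ^+ 2 / c <= a.
Proof.
move=> fz fy /(_ z); rewrite fz fy -EFinD lee_fin dotpZl -sqr_enorm.
by rewrite mulrC.
Qed.

(** The subgradient inequality at s, once c <(z - y) / c, y - s> is written as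
half of |z - s|^2 - |z - y|^2 - |y - s|^2. *)
Lemma prox_fejer c z y s b : 0 < c -> argmin f s -> f y = b%:E ->
  subdiff f y (c^-1 *: (z - y)) ->
  enorm (y - s) ^+ 2 + enorm (z - y) ^+ 2 + 2 * c * (b - m)
    <= enorm (z - s) ^+ 2.
Proof.
move=> c_gt0 /argminE fs fy /(_ s); rewrite fs fy -EFinD lee_fin.
rewrite dotpZl -(ler_pM2l c_gt0) mulrDr mulVKf ?gt_eqF // !sqr_enorm.
have -> : z - s = (z - y) - (s - y) by rewrite opprB addrA subrK.
rewrite -(opprB s y); move: (z - y) (s - y) => u v.
rewrite !dotpE (dotpC v u); lra.
Qed.

(** * The cycle of regularity conditions *)

Hypotheses (f_proper : proper_efunction f) (S_neq0 : argmin f !=set0).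

(** Cauchy-Schwarz bounds the right-hand side of (RSI) by |g| dist(x, S), and
one factor dist(x, S) cancels. *)
Lemma EB_of_RSI nu mu : RSI_with f nu mu -> EB_with f nu mu^-1.
Proof.
move=> [mu_gt0 rsi]; split=> [|x xnu]; first by rewrite invr_gt0.
have [p px] := projection_exists x closed_argmin S_neq0.
rewrite (dist_projection px); set D := enorm (x - p).
have -> : D = mu^-1 * (mu * D) by rewrite mulKf ?gt_eqF.
rewrite EFinM lee_pmul2l ?lte_fin ?invr_gt0 //; apply: le_dist0 => g xg.
have := rsi x g p xnu xg px.
rewrite (dist_projection px) -/D -EFin_expe -EFinM lee_fin => le_g.
have := cauchy_schwarz g (x - p); rewrite -/D => cs.
have [->|D_neq0] := eqVneq D 0; first by rewrite mulr0 enorm_ge0.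
have D_gt0 : 0 < D by rewrite lt_neqAle eq_sym D_neq0 enorm_ge0.
by rewrite -(ler_pM2r D_gt0) -mulrA -expr2; exact: le_trans le_g cs.
Qed.

(** For p the projection of x, f x - m <= <g, x - p> <= |g| dist(x, S), and (EB)
bounds the distance by mu |g|. *)
Lemma PL_of_EB nu mu : EB_with f nu mu -> PL_with f nu (2 * mu)^-1.
Proof.
move=> [mu_gt0 eb]; split=> [|x xnu]; first by rewrite invr_gt0 mulr_gt0.
have [a [fx ma _]] := sublevel_fin xnu.
have [p px] := projection_exists x closed_argmin S_neq0.
have /argminE fp := px.1.
rewrite fx fstarE -EFinB -EFinM; apply: le_sqr_dist0 => g xg.
have D_le : enorm (x - p) <= mu * enorm g.
  rewrite -lee_fin EFinM -(dist_projection px); apply: le_trans (eb x xnu) _.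
  by rewrite lee_pmul2l ?lte_fin ?dist0_le.
have := xg p; rewrite fx fp -EFinD lee_fin -(opprB x) dotpNr.
have := cauchy_schwarz g (x - p).
have -> : 2 * (2 * mu)^-1 = mu^-1 by field; lra.
rewrite ler_pdivrMl // => cs le_m; have := enorm_ge0 g; nra.
Qed.

(** With s = sqrt (2 mu), let (z, r) minimise sqrt (r - m) + (s / 4) |z - x| on
the epigraph, and let y be the proximal point of z with step 1 / s^2, at
distance d from z.  The descent inequality gives
f y - m + (s d)^2 <= f z - m, (PL) gives sqrt (f y - m) <= s d, and minimality
gives sqrt (f z - m) <= sqrt (f y - m) + s d / 4; by [descent_forces_zero], z is
in S.  Minimality against x then gives (s / 4) dist(x, S) <= sqrt (f x - m),
whose square is (QG), as (s / 4)^2 = mu / 8. *)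
Lemma QG_of_PL nu mu : PL_with f nu mu -> QG_with f nu (mu / 4).
Proof.
move=> [mu_gt0 pl]; split=> [|x xnu]; first by rewrite divr_gt0.
have [a [fx ma a_nu]] := sublevel_fin xnu.
pose s := Num.sqrt (2 * mu); have s_gt0 : 0 < s by rewrite sqrtr_gt0 mulr_gt0.
have s2 : s ^+ 2 = 2 * mu by rewrite sqr_sqrtr // mulr_ge0 // ltW.
have cG : continuous (fun q : 'rV[R]_n * R =>
    Num.sqrt (q.2 - m) + s / 4 * enorm (q.1 - x)).
  have csub : continuous (fun q : 'rV[R]_n * R => q.2 - m).
    by move=> q; apply: continuousB; [exact: cvg_snd | exact: cst_continuous].
  have csqrt : continuous (fun q : 'rV[R]_n * R => Num.sqrt (q.2 - m)).
    move=> q; apply: (@continuous_comp _ _ _ (fun q : 'rV[R]_n * R => q.2 - m)).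
      exact: csub.
    exact: sqrt_continuous.
  move=> q; apply: (continuousD (csqrt q)).
  apply: continuousM; first exact: cst_continuous.
  exact: enorm_fst_continuous.
have [|||z [r [zr minz]]] := @coercive_min _ _ (epigraph f)
    (fun q => Num.sqrt (q.2 - m) + s / 4 * enorm (q.1 - x)) x a
    (4 / s * Num.sqrt (a - m)) (`|a| + `|m|) f_closed.
- by rewrite /epigraph /= fx.
- exact: cG.
- move=> y r /= /le_fin_value /= [b [fy mb br]].
  rewrite subrr enorm0 mulr0 addr0 => le_a.
  have d_ge0 : 0 <= s / 4 * enorm (y - x).
    by rewrite mulr_ge0 ?enorm_ge0 // divr_ge0 // ltW.
  split.
    rewrite -[enorm _](mulKf (x := s / 4)); last by rewrite gt_eqF ?divr_gt0.
    rewrite invf_div ler_pM2l ?divr_gt0 //.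
    by have := sqrtr_ge0 (r - m); lra.
  have : Num.sqrt (r - m) <= Num.sqrt (a - m) by lra.
  rewrite ler_sqrt; last by lra.
  rewrite ler_norml; have := ler_norm a; have := ler_norm (- m); rewrite normrN.
  by have := normr_ge0 a; have := normr_ge0 m => *; apply/andP; split; lra.
rewrite /= in minz.
have [az [fz maz az_r]] : exists b, [/\ f z = b%:E, m <= b & b <= r].
  exact: le_fin_value zr.
have le_x := minz x a.
rewrite /epigraph /= fx lexx subrr enorm0 mulr0 addr0 in le_x.
have {}le_x := le_x isT.
have zx_ge0 : 0 <= s / 4 * enorm (z - x).
  by rewrite mulr_ge0 ?enorm_ge0 // divr_ge0 // ltW.
have r_a : r <= a.
  have : Num.sqrt (r - m) <= Num.sqrt (a - m) by lra.
  by rewrite ler_sqrt; lra.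
have Az : Num.sqrt (az - m) <= Num.sqrt (r - m) by rewrite ler_wsqrtr // lerD2r.
have c_gt0 : 0 < (s ^+ 2)^-1 by rewrite invr_gt0 exprn_gt0.
have [y /(prox_subgradient f_proper c_gt0)] := prox_exists c_gt0 fz.
rewrite invrK => -[b fy yg].
have mb : m <= b by have := fstar_le y; rewrite fy.
have := prox_descent (c := (s ^+ 2)^-1) fz fy; rewrite !invrK => /(_ yg).
set d := enorm (z - y) => desc.
have d_ge0 : 0 <= d := enorm_ge0 _.
have dsub : 0 <= d ^+ 2 * s ^+ 2 by rewrite -exprMn sqr_ge0.
have ynu : sublevel f (fstar f + nu%:E)%E y.
  by rewrite /sublevel /= fstarE fy -EFinD lee_fin; lra.
have PLy : b - m <= s ^+ 2 * d ^+ 2.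
  have := le_trans (pl y ynu) (sqr_dist0_le yg).
  rewrite fy fstarE -EFinB -EFinM lee_fin sqr_enorm dotpZl dotpZr -sqr_enorm.
  by rewrite -/d -s2 ler_pM2l ?exprn_gt0.
have le_y := minz y b; rewrite /epigraph /= fy lexx in le_y.
have {}le_y := le_y isT.
have tri : enorm (y - x) <= d + enorm (z - x).
  by rewrite -(subrKA z) /d (enorm_distC z y); exact: enormD.
have A0 : Num.sqrt (az - m) = 0.
  apply: (descent_forces_zero (B := Num.sqrt (b - m)) (e := s * d)).
  - exact: sqrtr_ge0.
  - exact: sqrtr_ge0.
  - by rewrite mulr_ge0 // ltW.
  - by rewrite !sqr_sqrtr ?subr_ge0 // exprMn; lra.
  - rewrite -ler_sqr ?nnegrE ?sqrtr_ge0 ?mulr_ge0 ?(ltW s_gt0) //.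
    by rewrite sqr_sqrtr ?subr_ge0 // exprMn.
  - by have := ler_wpM2l (ltW s_gt0) tri; lra.
have azm : az = m.
  by move/eqP: A0; rewrite sqrtr_eq0 subr_le0 => az_m; apply/le_anti/andP.
have [p px] := projection_exists x closed_argmin S_neq0.
have zS : argmin f z by apply/argminE; rewrite fz azm.
have := px.2 z zS; rewrite lee_fin => D_le.
rewrite (dist_projection px) fx fstarE -EFin_expe -EFinM -EFinB lee_fin.
have : s / 4 * enorm (x - p) <= Num.sqrt (a - m).
  apply: (@le_trans _ _ (s / 4 * enorm (z - x))).
    by rewrite ler_pM2l ?divr_gt0 // (enorm_distC z).
  by have := sqrtr_ge0 (r - m); lra.
have sD_ge0 : 0 <= s / 4 * enorm (x - p).
  by rewrite mulr_ge0 ?enorm_ge0 // divr_ge0 // ltW.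
rewrite -ler_sqr ?nnegrE ?sqrtr_ge0 //.
rewrite sqr_sqrtr ?subr_ge0 // !exprMn s2; lra.
Qed.

Lemma RSI_of_QG nu mu : QG_with f nu mu -> RSI_with f nu (mu / 2).
Proof.
move=> [mu_gt0 qg]; split=> [|x g p xnu xg px]; first by rewrite divr_gt0.
have [a [fx ma _]] := sublevel_fin xnu.
have /argminE fp := px.1.
have := qg x xnu; rewrite fx fstarE => /le_trans; apply.
have := xg p; rewrite fx fp -EFinB -EFinD !lee_fin -(opprB x) dotpNr; lra.
Qed.

Lemma regular_constants nu : PL f nu \/ EB f nu \/ RSI f nu \/ QG f nu ->
  [/\ exists mu, PL_with f nu mu, exists mu, EB_with f nu mu
    & exists mu, QG_with f nu mu].
Proof.
have plqg mu : PL_with f nu mu -> exists mu', QG_with f nu mu'.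
  by move=> /QG_of_PL; eexists; eassumption.
have qgeb mu : QG_with f nu mu -> exists mu', EB_with f nu mu'.
  by move=> /RSI_of_QG/EB_of_RSI; eexists; eassumption.
have ebpl mu : EB_with f nu mu -> exists mu', PL_with f nu mu'.
  by move=> /PL_of_EB; eexists; eassumption.
move=> reg; have [mu eb] : exists mu, EB_with f nu mu.
  case: reg => [[mu /plqg[mu' /qgeb]]|[//|[[mu /EB_of_RSI]|[mu /qgeb]]]] //.
  by eexists; eassumption.
have [mu' pl] := ebpl _ eb.
by split; [exists mu' | exists mu | exact: plqg pl].
Qed.

(** * Rates of the proximal point method *)

(** (PL) bounds the decrease |z - y|^2 / c of the values from below by
2 c mu (f y - m), so that even the factor 1 / (1 + 2 c mu) would do. *)
Lemma prox_value_contraction c z y nu mu a : 0 < c -> PL_with f nu mu ->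
  f z = a%:E -> a <= m + nu -> argmin (prox_objective f c z) y ->
  exists2 b, f y = b%:E & b - m <= 1 / (1 + c * mu) * (a - m).
Proof.
move=> c_gt0 [mu_gt0 pl] fz a_nu /(prox_subgradient f_proper c_gt0)[b fy yg].
exists b => //; have := prox_descent fz fy yg.
have mb : m <= b by have := fstar_le y; rewrite fy.
set d := enorm (z - y) => desc.
have : sublevel f (fstar f + nu%:E)%E y.
  rewrite /sublevel /= fstarE fy -EFinD lee_fin.
  have : 0 <= d ^+ 2 / c by rewrite divr_ge0 ?sqr_ge0 ?ltW.
  lra.
move=> /pl /le_trans /(_ (sqr_dist0_le yg)).
rewrite fy fstarE -EFinB -EFinM lee_fin.
rewrite sqr_enorm dotpZl dotpZr -sqr_enorm -/d => PLy.
have cmu : 0 < c * mu by rewrite mulr_gt0.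
rewrite mul1r ler_pdivlMl; last lra.
have : c * (2 * mu * (b - m)) <= d ^+ 2 / c.
  rewrite -ler_pdivlMl //; apply: le_trans PLy _.
  by rewrite (mulrC (d ^+ 2)).
by nra.
Qed.

(** In [prox_fejer] for s the projection of z, the term |y - s|^2 is at least
dist^2(y, S).  Next to it, (QG) bounds 2 c (f y - m) from below by
c mu_q dist^2(y, S), and (EB) bounds |z - y|^2 from below by
(c / mu_e)^2 dist^2(y, S); each of these gives one of the two factors. *)
Lemma prox_dist_contraction c z y nu mu_e mu_q a : 0 < c ->
  EB_with f nu mu_e -> QG_with f nu mu_q ->
  f z = a%:E -> a <= m + nu -> argmin (prox_objective f c z) y ->
  (dist y (argmin f) <= (Num.min (1 / Num.sqrt (c * mu_q + 1))
      (1 / Num.sqrt (c ^+ 2 / mu_e ^+ 2 + 1)))%:E * dist z (argmin f))%E.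
Proof.
move=> c_gt0 [e_gt0 eb] [q_gt0 qg] fz a_nu.
move=> /(prox_subgradient f_proper c_gt0)[b fy yg].
have := prox_descent fz fy yg.
have mb : m <= b by have := fstar_le y; rewrite fy.
have [p pz] := projection_exists z closed_argmin S_neq0.
have [q py] := projection_exists y closed_argmin S_neq0.
have := prox_fejer c_gt0 pz.1 fy yg.
have := py.2 _ pz.1; rewrite lee_fin => D_le.
rewrite (dist_projection pz) (dist_projection py) -EFinM lee_fin.
set d := enorm (z - y) => fej desc.
have ynu : sublevel f (fstar f + nu%:E)%E y.
  rewrite /sublevel /= fstarE fy -EFinD lee_fin.
  have : 0 <= d ^+ 2 / c by rewrite divr_ge0 ?sqr_ge0 ?ltW.
  lra.
have := qg _ ynu.
rewrite (dist_projection py) fy fstarE -EFinB -EFin_expe -EFinM lee_fin.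
have : enorm (y - q) <= mu_e * (c^-1 * d).
  rewrite -lee_fin EFinM -(dist_projection py); apply: le_trans (eb _ ynu) _.
  rewrite lee_pmul2l ?lte_fin //; apply: le_trans (dist0_le yg) _.
  rewrite lee_fin /enorm dotpZl dotpZr mulrA -expr2 sqrtrM ?sqr_ge0 //.
  by rewrite sqrtr_sqr ger0_norm // invr_ge0 ltW.
have := enorm_ge0 (z - p); have := enorm_ge0 (y - q).
move: (enorm (y - q)) (enorm (y - p)) (enorm (z - p)) D_le fej => D E Z.
move=> D_le fej D_ge0 Z_ge0 EBy QGy.
have D2 : D ^+ 2 <= E ^+ 2 by rewrite ler_sqr ?nnegrE //; apply: le_trans D_le.
have d_ge0 : 0 <= d := enorm_ge0 _.
have d2 : 0 <= d ^+ 2 := sqr_ge0 d.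
have cb : 0 <= 2 * c * (b - m) by rewrite mulr_ge0 ?subr_ge0 // mulr_ge0 // ltW.
have thq : D <= 1 / Num.sqrt (c * mu_q + 1) * Z.
  apply: le_contraction => //; first by have := mulr_gt0 c_gt0 q_gt0; lra.
  by have := ler_wpM2l (ltW c_gt0) QGy; lra.
have the : D <= 1 / Num.sqrt (c ^+ 2 / mu_e ^+ 2 + 1) * Z.
  apply: le_contraction => //.
    by have := divr_gt0 (exprn_gt0 2 c_gt0) (exprn_gt0 2 e_gt0); lra.
  suff : D ^+ 2 * (c ^+ 2 / mu_e ^+ 2) <= d ^+ 2 by lra.
  have Dc_ge0 : 0 <= D * (c / mu_e) by rewrite mulr_ge0 // divr_ge0 // ltW.
  rewrite -expr_div_n -exprMn ler_sqr ?nnegrE //.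
  rewrite mulrA ler_pdivrMr // -ler_pdivlMr //.
  by have -> : d * mu_e / c = mu_e * (c^-1 * d) by ring.
by rewrite /Num.min; case: ifP.
Qed.

(** [prox_fejer] summed along the iteration; since the values decrease, each of
the k + 1 summands f (x j) - m can be replaced by the last one.  The value at
x 0 is left out because it may be +oo. *)
Lemma proximal_point_value_bound (c : nat -> R) (x : nat -> 'rV[R]_n) e s k :
  0 < e -> (forall k, e <= c k) -> proximal_point_sequence f c x ->
  argmin f s ->
  exists b, f (x k.+1) = b%:E /\
    enorm (x k.+1 - s) ^+ 2 + 2 * e * k.+1%:R * (b - m)
      <= enorm (x 0%N - s) ^+ 2.
Proof.
move=> e_gt0 e_c xprox sS.
have c_gt0 j : 0 < c j by exact: lt_le_trans (e_c j).
have step j b : f (x j.+1) = b%:E ->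
    enorm (x j.+1 - s) ^+ 2 + 2 * e * (b - m) <= enorm (x j - s) ^+ 2.
  move=> fb; have [b' fb' xg] := prox_subgradient f_proper (c_gt0 j) (xprox j).
  have := prox_fejer (c_gt0 j) sS fb xg.
  have mb : m <= b by have := fstar_le (x j.+1); rewrite fb.
  have := sqr_ge0 (enorm (x j - x j.+1)); have := e_c j; nra.
elim: k => [|k [b [fb IH]]].
  have [b fb _] := prox_subgradient f_proper (c_gt0 0) (xprox 0).
  by exists b; rewrite fb mulr1; split=> //; exact: step.
have [b' fb' xg] := prox_subgradient f_proper (c_gt0 k.+1) (xprox k.+1).
exists b'; split=> //; apply: le_trans IH.
have := step _ _ fb'; have := prox_descent fb fb' xg.
have : 0 <= enorm (x k.+1 - x k.+2) ^+ 2 / c k.+1.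
  by rewrite divr_ge0 ?sqr_ge0 ?ltW.
move=> d_ge0 desc st.
have : 2 * e * k.+1%:R * (b' - m) <= 2 * e * k.+1%:R * (b - m).
  by rewrite ler_pM2l ?lerD2r ?mulr_gt0 ?ltr0n //; lra.
by rewrite -[k.+2%:R]natr1; lra.
Qed.

Lemma proximal_point_sublevel (c : nat -> R) (x : nat -> 'rV[R]_n) nu k :
  0 < nu -> (exists2 e : R, 0 < e & forall k, e <= c k) ->
  proximal_point_sequence f c x ->
  (dist (x 0%N) (argmin f) ^+ 2 / (2 * nu * inf (range c))%:E <= k%:R%:E)%E ->
  exists2 a, f (x k) = a%:E & a <= m + nu.
Proof.
move=> nu_gt0 [e e_gt0 e_c] xprox.
have lbc : has_lbound (range c) by exists e => _ [j _ <-].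
have i_gt0 : 0 < inf (range c).
  apply: lt_le_trans e_gt0 _; apply: lb_le_inf; first by exists (c 0%N), 0%N.
  by move=> _ [j _ <-].
have i_c j : inf (range c) <= c j by apply: ge_inf => //; exists j.
move: (inf (range c)) i_gt0 i_c => i i_gt0 i_c.
have [p px] := projection_exists (x 0%N) closed_argmin S_neq0.
have ni_gt0 : 0 < 2 * nu * i by rewrite !mulr_gt0.
rewrite (dist_projection px) -EFin_expe inver gt_eqF // -EFinM lee_fin.
rewrite ler_pdivrMr // => k_ge.
(* For k = 0 the hypothesis says that x 0 is already a minimiser. *)
case: k k_ge => [|k] k_ge.
  have D0 : enorm (x 0%N - p) = 0.
    by apply/eqP; rewrite -sqrf_eq0 eq_le sqr_ge0 andbT; lra.
  have /eqP := enorm_eq0 D0; rewrite subr_eq0 => /eqP ->.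
  by exists m; [exact/argminE/px.1 | lra].
have [b [fb bnd]] := proximal_point_value_bound k i_gt0 i_c xprox px.1.
exists b => //; have := sqr_ge0 (enorm (x k.+1 - p)) => ge0.
have : (2 * i * k.+1%:R) * (b - m) <= (2 * i * k.+1%:R) * nu by lra.
by rewrite ler_pM2l ?mulr_gt0 ?ltr0n //; lra.
Qed.

End ClosedConvexFunction.

Theorem theorem4p2 (R : realType) (n : nat) (f : 'rV[R]_n -> \bar R) (nu : R)
    (c : nat -> R) (x : nat -> 'rV[R]_n)
    (f_proper : proper_efunction f) (f_closed : closed_efunction f)
    (f_convex : convex_efunction f)
    (S_neq0 : argmin f !=set0) (nu_gt0 : 0 < nu)
    (regular : PL f nu \/ EB f nu \/ RSI f nu \/ QG f nu)
    (c_gt0 : forall k, 0 < c k)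
    (c_away0 : exists2 e : R, 0 < e & forall k, e <= c k)
    (x_prox : proximal_point_sequence f c x) :
  [/\ exists mu_p, PL_with f nu mu_p,
      exists mu_e, EB_with f nu mu_e,
      exists mu_q, QG_with f nu mu_q &
      forall mu_p mu_e mu_q : R,
        PL_with f nu mu_p -> EB_with f nu mu_e -> QG_with f nu mu_q ->
        forall k : nat,
          (dist (x 0%N) (argmin f) ^+ 2 / (2 * nu * inf (range c))%:E
             <= k%:R%:E)%E ->
          let omega := 1 / (1 + c k * mu_p) in
          let theta := Num.min (1 / Num.sqrt (c k * mu_q + 1))
                               (1 / Num.sqrt (c k ^+ 2 / mu_e ^+ 2 + 1)) in
          [/\ (f (x k.+1) - fstar f <= omega%:E * (f (x k) - fstar f))%E,
              omega < 1,
              (dist (x k.+1) (argmin f) <= theta%:E * dist (x k) (argmin f))%E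
            & theta < 1]].
Proof.
have [m fm] := fstar_fin f_proper S_neq0.
have [pl eb qg] :=
  regular_constants f_closed f_convex fm f_proper S_neq0 regular.
split=> // mu_p mu_e mu_q plp ebe qgq k k0 omega theta.
have [a fa a_nu] :=
  proximal_point_sublevel f_closed f_convex fm f_proper S_neq0 nu_gt0 c_away0
    x_prox k0.
have [b fb ba] :=
  prox_value_contraction f_convex fm f_proper (c_gt0 k) plp fa a_nu (x_prox k).
have cmu : 0 < c k * mu_p by rewrite mulr_gt0 // plp.1.
split.
- by rewrite fb fa fm -!EFinB -EFinM lee_fin.
- by rewrite /omega mul1r invf_lt1; lra.
- exact: (prox_dist_contraction f_closed f_convex fm f_proper S_neq0 (c_gt0 k)
    ebe qgq fa a_nu (x_prox k)).
- have cmq : 0 < c k * mu_q by rewrite mulr_gt0 // qgq.1.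
  rewrite gt_min; apply/orP; left; rewrite mul1r invf_lt1 ?sqrtr_gt0; last lra.
  by rewrite -[ltLHS]sqrtr1 ltr_sqrt; lra.
Qed.
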